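(* Let $k$ be a field of characteristic zero, ${\boldsymbol\lambda}\in M_n(k)$ antisymmetric, $A=k_{\boldsymbol\lambda}[x_1,\dots,x_n]$, and let $P$ be a Poisson prime ideal of $A$. Then there exist a field extension $K\supseteq k$ and an antisymmetric matrix ${\boldsymbol\mu}\in M_m(k)$, for some $m\le n$, such that $\operatorname{Fract}A/P\cong K_{\boldsymbol\mu}(y_1,\dots,y_m)$ as Poisson algebras. Moreover, ${\boldsymbol\mu}$ is the upper left $m\times m$ submatrix of ${\boldsymbol\sigma}{\boldsymbol\lambda}{\boldsymbol\sigma}^{\mathrm{tr}}$ for some ${\boldsymbol\sigma}\in GL_n(\mathbb Z)$.
   Context: For an antisymmetric matrix ${\boldsymbol\lambda}=(\lambda_{ij})\in M_n(k)$, $k_{\boldsymbol\lambda}[x_1,\dots,x_n]$ denotes the polynomial algebra with the unique Poisson bracket satisfying $\{x_i,x_j\}=\lambda_{ij}x_ix_j$ for all $i,j$. For a field $K\supseteq k$ and antisymmetric ${\boldsymbol\mu}\in M_m(k)$, $K_{\boldsymbol\mu}(y_1,\dots,y_m)$ denotes the rational function field over $K$ with the unique $K$-linear Poisson bracket satisfying $\{y_i,y_j\}=\mu_{ij}y_iy_j$. A Poisson prime ideal is a prime ideal $P$ with $\{A,P\}\subseteq P$; the bracket on $A/P$ extends uniquely to $\operatorname{Fract}A/P$. *)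

(* Defs.v *)
From HB Require Import structures.
From mathcomp Require Import all_boot all_order all_algebra.
From mathcomp Require Import generic_quotient ring_quotient fraction.
From mathcomp Require Import mpoly.
From Stdlib Require Import ClassicalEpsilon.

Set Implicit Arguments.
Unset Strict Implicit.
Unset Printing Implicit Defensive.

Import GRing.Theory.
Local Open Scope ring_scope.
Local Open Scope quotient_scope.

Notation "x %:F" := (@FracField.tofrac _ x) : ring_scope.

(* The log-canonical Poisson bracket on R[x_1..x_n]:                    *)
(*   {f,g} = sum_{i,j} lam_ij x_i x_j (d f/d x_i) (d g/d x_j),          *)
(* i.e. the unique (R-bilinear, biderivation) bracket with              *)
(*   {x_i,x_j} = lam_ij x_i x_j.                                        *)
Definition qbracket (R : comNzRingType) (n : nat) (lam : 'M[R]_n)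
    (f g : {mpoly R[n]}) : {mpoly R[n]} :=
  \sum_(i < n) \sum_(j < n)
     lam i j *: ('X_i * 'X_j * (mderiv i f) * (mderiv j g)).

Definition antisym_mx (R : nzRingType) (n : nat) (M : 'M[R]_n) : Prop :=
  M^T = - M.

Definition poisson_ideal (R : comNzRingType) (n : nat) (lam : 'M[R]_n)
    (P : {pred {mpoly R[n]}}) : Prop :=
  forall a b, b \in P -> qbracket lam a b \in P.

(* The quotient A/P by a prime ideal, equipped (classically) with its   *)
(* integral domain structure, so that its fraction field exists.         *)
Section PrimeQuotient.
Variables (R : comNzRingType) (I : prime_idealr R).

Definition pquot := {ideal_quot I}.
HB.instance Definition _ := GRing.ComNzRing.on pquot.
HB.instance Definition _ := EqQuotient.on pquot.

Definition pq_unit : {pred pquot} :=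
  fun x => if excluded_middle_informative (exists y : pquot, y * x = 1)
           then true else false.

Definition pq_inv (x : pquot) : pquot :=
  match excluded_middle_informative (exists y : pquot, y * x = 1) with
  | left H => proj1_sig (constructive_indefinite_description _ H)
  | right _ => x
  end.

Lemma pq_mulVx : {in pq_unit, left_inverse 1 pq_inv *%R}.
Proof.
move=> x; rewrite unfold_in /pq_unit /pq_inv.
case: excluded_middle_informative => // H _.
exact: (proj2_sig (constructive_indefinite_description _ H)).
Qed.

Lemma pq_unitPl (x y : pquot) : y * x = 1 -> pq_unit x.
Proof.
move=> Hyx; rewrite /pq_unit.
case: excluded_middle_informative => // H; exfalso; apply: H; by exists y.
Qed.

Lemma pq_invr_out : {in [predC pq_unit], pq_inv =1 id}.
Proof.
move=> x; rewrite inE /= unfold_in /pq_unit /pq_inv.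
by case: excluded_middle_informative.
Qed.

HB.instance Definition _ :=
  GRing.ComNzRing_hasMulInverse.Build pquot pq_mulVx pq_unitPl pq_invr_out.

Lemma pq_integral : GRing.integral_domain_axiom pquot.
Proof. move=> x y; exact: Quotient.rquot_IdomainAxiom. Qed.

HB.instance Definition _ := GRing.ComUnitRing_isIntegral.Build pquot pq_integral.

End PrimeQuotient.

(* Induced bracket on A/P (well defined when P is a Poisson ideal). *)
Definition quot_bracket (R : comNzRingType) (n : nat) (lam : 'M[R]_n)
    (P : prime_idealr {mpoly R[n]}) (a b : pquot P) : pquot P :=
  \pi_(pquot P) (qbracket lam (repr a) (repr b)).

(* Unique extension of a Poisson bracket on an integral domain D to its *)
(* fraction field: for x = a/b, y = c/d,                                *)
(*  {x,y} = ({a,c} b d - {a,d} b c - {b,c} a d + {b,d} a c) / (b^2 d^2). *)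
Definition frac_bracket (D : idomainType) (br : D -> D -> D)
    (x y : {fraction D}) : {fraction D} :=
  let u := repr x in let v := repr y in
  let a := \n_u in let b := \d_u in let c := \n_v in let d := \d_v in
  (br a c * b * d - br a d * b * c - br b c * a * d + br b d * a * c)%:F
    / (b * b * d * d)%:F.

Definition FractQ (k : fieldType) (n : nat) (P : prime_idealr {mpoly k[n]}) :=
  {fraction (pquot P)}.

Definition ratfun_bracket (k K : fieldType) (iota : {rmorphism k -> K})
    (m : nat) (mu : 'M[k]_m) :=
  frac_bracket (qbracket (map_mx iota mu)).

(* Main.v *)
Require Import Defs.
From HB Require Import structures.
From mathcomp Require Import all_boot all_order all_algebra.
From mathcomp Require Import generic_quotient ring_quotient fraction.
From mathcomp Require Import mpoly perm ring.
From Stdlib Require Import ClassicalEpsilon.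

Set Implicit Arguments.
Unset Strict Implicit.
Unset Printing Implicit Defensive.

Import GRing.Theory.
Local Open Scope ring_scope.
Local Open Scope quotient_scope.

(* Write F = Fract A/P and take K to be the Poisson centre of F.  Replacing the
   images of the x_i that vanish by 1 and erasing the corresponding entries of
   lam, one gets nonzero log-canonical generators eta_i of F.  In characteristic
   zero, the integer vectors killed by lam form a direct summand of Z^n; let
   sigma be a basis of Z^n whose rows of index >= m span this summand.  Put
   y_j = eta^(sigma_j).  For j >= m these monomials lie in K, so F is generated
   by K and y_1, ..., y_m.  The monomials in y_1, ..., y_m are joint eigenvectors
   with distinct eigenvalues of the K-linear operators {-, eta_b} / eta_b, so the
   y_j are algebraically independent over K. *)

(** * Derivations and skew biderivations *)

(** Here [L] is a module over [D] through [f]. With [f] the identity these are derivations of a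
    ring; with [f] the embedding of a domain into its fraction field they are the derivations that
    the quotient rule extends. *)
Definition derivation_along (D L : comNzRingType) (f d : D -> L) : Prop :=
  (forall a b, d (a + b) = d a + d b) /\
  (forall a b, d (a * b) = f a * d b + d a * f b).

(** Additivity and the Leibniz rule are recorded in the first argument; skew-symmetry carries them
    over to the second. *)
Record skew_bider (R : comNzRingType) (B : R -> R -> R) : Prop := SkewBider {
  bider_skew : forall x y, B x y = - B y x;
  bider_addl : forall z x y, B (x + y) z = B x z + B y z;
  bider_mull : forall z x y, B (x * y) z = x * B y z + B x z * y }.

Section SkewBider.
Variables (R : comNzRingType) (B : R -> R -> R) (HB : skew_bider B).

Lemma bider_derl z : derivation_along id (B^~ z).
Proof. by split=> a b; [apply: bider_addl | apply: bider_mull]. Qed.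

Lemma bider_derr z : derivation_along id (B z).
Proof.
split=> a b; rewrite !(bider_skew HB z).
  by rewrite bider_addl // opprD.
by rewrite bider_mull // opprD mulrN mulNr.
Qed.

End SkewBider.

Section Derivation.
Variables (D L : comNzRingType) (f d : D -> L).
Hypothesis dd : derivation_along f d.

Lemma derD a b : d (a + b) = d a + d b. Proof. exact: dd.1. Qed.

Lemma derM a b : d (a * b) = f a * d b + d a * f b. Proof. exact: dd.2. Qed.

Lemma der0 : d 0 = 0.
Proof. by apply/(addrI (d 0)); rewrite -derD !addr0. Qed.

Lemma der1 : f 1 = 1 -> d 1 = 0.
Proof.
move=> f1; apply/(addrI (d 1)).
by rewrite addr0 -[in RHS](mulr1 1) derM f1 mulr1 mul1r.
Qed.

Lemma derN a : d (- a) = - d a.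
Proof. by apply/eqP; rewrite -addr_eq0 -derD addNr der0. Qed.

End Derivation.

Section FieldDerivation.
Variables (F : fieldType) (d : F -> F).
Hypothesis dd : derivation_along id d.

Lemma derV x : d x^-1 = - (x^-1 * x^-1 * d x).
Proof.
have [->|x0] := eqVneq x 0; first by rewrite invr0 (der0 dd) mulr0 oppr0.
have := der1 dd erefl; rewrite -(mulfV x0) (derM dd) /=.
by move/eqP; rewrite addr_eq0 => /eqP E; apply: (mulfI x0); rewrite E; field.
Qed.

(** Logarithmic derivatives turn products into sums; this is what makes brackets of Laurent
    monomials linear in the exponents. *)
Lemma dlogM x y : x != 0 -> y != 0 -> d (x * y) / (x * y) = d x / x + d y / y.
Proof. by move=> x0 y0; rewrite (derM dd) /=; field; rewrite x0 y0. Qed.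

Lemma dlogX x n : x != 0 -> d (x ^+ n) / x ^+ n = n%:R * (d x / x).
Proof.
move=> x0; elim: n => [|n IHn]; first by rewrite expr0 (der1 dd erefl) !mul0r.
by rewrite exprS dlogM ?expf_neq0 // IHn -natr1 mulrDl mul1r addrC.
Qed.

Lemma dlogXz (x : F) (z : int) : x != 0 -> d (x ^ z) / x ^ z = z%:~R * (d x / x).
Proof.
move=> x0; case: z => n; first exact: dlogX.
have xn0 : x ^+ n.+1 != 0 by rewrite expf_neq0.
rewrite NegzE -exprnN mulrNz mulNr -[_%:~R]/(n.+1%:R) -dlogX // derV.
by rewrite invrK; field.
Qed.

Lemma dlog_prod (I : Type) (r : seq I) (G : I -> F) : (forall i, G i != 0) ->
  d (\prod_(i <- r) G i) / \prod_(i <- r) G i = \sum_(i <- r) d (G i) / G i.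
Proof.
move=> G0; elim: r => [|i r IHr].
  by rewrite !big_nil (der1 dd erefl) mul0r.
have p0 : \prod_(j <- r) G j != 0.
  by elim/big_ind: _ => //; [apply: oner_neq0 | apply: mulf_neq0].
by rewrite !big_cons dlogM // IHr.
Qed.

End FieldDerivation.

(** * The quotient rule for derivations and for brackets *)

Section QuotientRule.
Variables (D : idomainType) (L : fieldType) (f : {rmorphism D -> L}).

Definition quotient_rule (d : D -> L) (a b : D) : L :=
  (d a * f b - f a * d b) / (f b * f b).

Section OneDerivation.
Variables (d : D -> L) (dd : derivation_along f d).

(** Applying [f] and [d] to the cross relation determines [f a] and [d a]; after substitution both
    sides are the same rational expression. *)
Lemma quotient_rule_indep a b a' b' : f b != 0 -> f b' != 0 ->
  a * b' = a' * b -> quotient_rule d a b = quotient_rule d a' b'.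
Proof.
move=> b0 b'0 E; have := congr1 d E; rewrite !(derM dd) => dE.
have := congr1 f E; rewrite !rmorphM => fE; rewrite /quotient_rule.
have aE : f a = f a' * f b / f b' by rewrite -fE mulfK.
have daE : d a = (f a' * d b + d a' * f b - f a * d b') / f b'.
  by rewrite -dE [_ + _ * f b']addrC addrK mulfK.
by rewrite daE aE; field; rewrite ?b0 ?b'0.
Qed.

Lemma quotient_ruleD a b a' b' : f b != 0 -> f b' != 0 ->
  quotient_rule d (a * b' + a' * b) (b * b') =
  quotient_rule d a b + quotient_rule d a' b'.
Proof.
move=> b0 b'0; rewrite /quotient_rule (derD dd) !(derM dd) rmorphD !rmorphM.
by field; rewrite ?b0 ?b'0.
Qed.

Lemma quotient_ruleM a b a' b' : f b != 0 -> f b' != 0 ->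
  quotient_rule d (a * a') (b * b') =
  f a / f b * quotient_rule d a' b' + quotient_rule d a b * (f a' / f b').
Proof.
move=> b0 b'0; rewrite /quotient_rule !(derM dd) !rmorphM.
by field; rewrite ?b0 ?b'0.
Qed.

End OneDerivation.

Variables (br : D -> D -> D) (br_bider : skew_bider br).

(** The one-variable rule iterated: inside in the fraction c/d, outside in a/b. Expanded, it is the
    four-term formula of [frac_bracket], so facts about that bracket reduce to facts about a single
    derivation. *)
Definition quotient_rule2 a b c d : L :=
  quotient_rule (fun a => quotient_rule (fun c => f (br a c)) c d) a b.

Lemma bracket_derr a : derivation_along f (fun c => f (br a c)).
Proof.
have [rD rM] := bider_derr br_bider a.
by split=> x y; rewrite ?rD ?rM !(rmorphD, rmorphM).
Qed.

Lemma quotient_rule_derl c d : f d != 0 ->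
  derivation_along f (fun a => quotient_rule (fun c => f (br a c)) c d).
Proof.
move=> d0; split=> x y; rewrite /quotient_rule.
  by rewrite !(bider_addl br_bider) !rmorphD; field.
by rewrite !(bider_mull br_bider) !rmorphD !rmorphM; field.
Qed.

Lemma quotient_rule2E a b c d : f b != 0 -> f d != 0 ->
  f (br a c * b * d - br a d * b * c - br b c * a * d + br b d * a * c)
    / f (b * b * d * d) = quotient_rule2 a b c d.
Proof.
move=> b0 d0; rewrite /quotient_rule2 /quotient_rule.
by rewrite !(rmorphD, rmorphN, rmorphM) /=; field; rewrite ?b0 ?d0.
Qed.

Lemma quotient_rule2_skew a b c d : f b != 0 -> f d != 0 ->
  quotient_rule2 a b c d = - quotient_rule2 c d a b.
Proof.
move=> b0 d0; rewrite /quotient_rule2 /quotient_rule.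
rewrite !(bider_skew br_bider c) !(bider_skew br_bider d) !rmorphN.
by field; rewrite ?b0 ?d0.
Qed.

Lemma quotient_rule2_indep a b c d a' b' c' d' :
    f b != 0 -> f d != 0 -> f b' != 0 -> f d' != 0 ->
    a * b' = a' * b -> c * d' = c' * d ->
  quotient_rule2 a b c d = quotient_rule2 a' b' c' d'.
Proof.
move=> b0 d0 b'0 d'0 Eab Ecd; rewrite /quotient_rule2.
rewrite (quotient_rule_indep (quotient_rule_derl c d0) b0 b'0 Eab).
have Ecd' x := quotient_rule_indep (bracket_derr x) d0 d'0 Ecd.
by rewrite [LHS]/quotient_rule !Ecd'.
Qed.

End QuotientRule.

(** * Fraction fields *)

Section Fraction.
Variable D : idomainType.

Lemma fracE (x : {fraction D}) : x = (\n_(repr x))%:F / (\d_(repr x))%:F.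
Proof.
have dx0 : (\d_(repr x))%:F != 0 by rewrite tofrac_eq0 denom_ratioP.
apply: (mulIf dx0); rewrite divfK // -{1}[x]reprK.
unlock FracField.tofrac; rewrite -[LHS]FracField.pi_mul.
apply/eqmodP; rewrite /= FracField.equivfE /FracField.mulf.
by rewrite !numden_Ratio ?mulf_neq0 ?oner_neq0 ?denom_ratioP // !mulr1 mulrC.
Qed.

Lemma fracP (x : {fraction D}) : exists a b, b != 0 /\ x = a%:F / b%:F.
Proof.
by exists \n_(repr x), \d_(repr x); split; [apply: denom_ratioP | apply: fracE].
Qed.

Section Lift.
Variables (L : fieldType) (f : {rmorphism D -> L}) (f_inj : injective f).

Definition frac_lift (x : {fraction D}) : L := f \n_(repr x) / f \d_(repr x).

Let f0 (a : D) : a != 0 -> f a != 0.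
Proof. by apply: contraNneq => fa0; rewrite (f_inj (etrans fa0 (esym (rmorph0 f)))). Qed.

(** The chosen representative is cross-equal to the pair [a], [b], and injectivity of [f] keeps both
    denominators nonzero in [L]. *)
Lemma frac_lift_div (a b : D) : b != 0 -> frac_lift (a%:F / b%:F) = f a / f b.
Proof.
move=> b0; rewrite /frac_lift; set x := a%:F / b%:F.
have dx0 : \d_(repr x) != 0 by apply: denom_ratioP.
have: a%:F / b%:F = (\n_(repr x))%:F / (\d_(repr x))%:F by rewrite -fracE.
move/eqP; rewrite eqr_div ?tofrac_eq0 // -!tofracM tofrac_eq => /eqP E.
by apply/eqP; rewrite eqr_div ?f0 // -!rmorphM E.
Qed.

Lemma frac_lift_tofrac a : frac_lift a%:F = f a.
Proof. by rewrite -[a%:F]divr1 -tofrac1 frac_lift_div ?oner_neq0 // rmorph1 divr1. Qed.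

Lemma frac_lift_is_zmod_morphism : zmod_morphism frac_lift.
Proof.
move=> x y; have [a [b [b0 ->]]] := fracP x; have [c [d [d0 ->]]] := fracP y.
rewrite -mulNr -tofracN addf_div ?tofrac_eq0 // -!tofracM -tofracD.
rewrite !frac_lift_div ?mulf_neq0 // rmorphD !rmorphM rmorphN.
by rewrite -addf_div ?f0 // mulNr.
Qed.

Lemma frac_lift_is_monoid_morphism : monoid_morphism frac_lift.
Proof.
split=> [|x y]; first by rewrite -tofrac1 frac_lift_tofrac rmorph1.
have [a [b [b0 ->]]] := fracP x; have [c [d [d0 ->]]] := fracP y.
rewrite mulf_div -!tofracM !frac_lift_div ?mulf_neq0 // !rmorphM /=.
by rewrite mulf_div.
Qed.

Lemma frac_extend : exists g : {rmorphism {fraction D} -> L}, forall a, g a%:F = f a.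
Proof.
pose zM := GRing.isZmodMorphism.Build _ _ frac_lift frac_lift_is_zmod_morphism.
pose mM := GRing.isMonoidMorphism.Build _ _ frac_lift frac_lift_is_monoid_morphism.
pose g : {rmorphism {fraction D} -> L} := HB.pack frac_lift zM mM.
by exists g; apply: frac_lift_tofrac.
Qed.

End Lift.

Section Bracket.
Variables (br : D -> D -> D) (br_bider : skew_bider br).
Local Notation B := (frac_bracket br).

Let f0 (a : D) : a != 0 -> a%:F != 0 :> {fraction D}.
Proof. by rewrite tofrac_eq0. Qed.

Local Notation toF := (@FracField.tofrac D).

(** The definition computes with chosen representatives; independence of the representative moves
    the formula to any pair of fractions. *)
Lemma frac_bracket_div a b c d : b != 0 -> d != 0 ->
  B (a%:F / b%:F) (c%:F / d%:F) = quotient_rule2 toF br a b c d.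
Proof.
move=> b0 d0.
rewrite /frac_bracket; set x := a%:F / b%:F; set y := c%:F / d%:F.
have cross (p q : D) (z : {fraction D}) : q != 0 -> z = p%:F / q%:F ->
    \n_(repr z) * q = p * \d_(repr z).
  move=> q0 zE; have := fracE z; rewrite [in LHS]zE.
  move/eqP; rewrite eqr_div ?f0 ?denom_ratioP // -!tofracM tofrac_eq.
  by move/eqP=> ->.
rewrite /= (quotient_rule2E (f := toF)) ?f0 ?denom_ratioP //.
by apply: quotient_rule2_indep; rewrite ?f0 ?denom_ratioP //; apply: cross.
Qed.

Lemma frac_bracket_tofrac (a b : D) : B a%:F b%:F = (br a b)%:F.
Proof.
have br1 x : br x 1 = 0 := der1 (bider_derr br_bider x) erefl.
have br1l x : br 1 x = 0 := der1 (bider_derl br_bider x) erefl.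
rewrite -[a%:F]divr1 -[b%:F]divr1 -tofrac1 frac_bracket_div ?oner_neq0 //.
by rewrite /quotient_rule2 /quotient_rule
  !(br1, br1l, tofrac0, tofrac1, mulr0, mulr1, mul0r, subr0, divr1).
Qed.

Lemma frac_bracket_bider : skew_bider B.
Proof.
split=> [x y|z x y|z x y];
    have [a [b [b0 ->]]] := fracP x; have [a' [b' [b'0 ->]]] := fracP y.
- by rewrite !frac_bracket_div // quotient_rule2_skew // ?f0.
- have [c [d [d0 ->]]] := fracP z.
  rewrite addf_div ?f0 // -!tofracM -tofracD !frac_bracket_div ?mulf_neq0 //.
  by apply: quotient_ruleD; rewrite ?f0 //; apply: quotient_rule_derl; rewrite ?f0.
- have [c [d [d0 ->]]] := fracP z.
  rewrite mulf_div -!tofracM !frac_bracket_div ?mulf_neq0 //.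
  by apply: quotient_ruleM; rewrite ?f0 //; apply: quotient_rule_derl; rewrite ?f0.
Qed.

End Bracket.

End Fraction.

(** * Integral bases adapted to a kernel *)

Section AdaptedBasis.
Variables (k : fieldType) (k_char0 : [pchar k] =i pred0).

Local Notation intk := (fun z : int => z%:~R : k).
Local Notation "A ^k" := (map_mx intk A) (at level 2, format "A ^k").

(** Characteristic zero enters the argument here. *)
Lemma intr_char0_eq0 (z : int) : (z%:~R == 0 :> k) = (z == 0).
Proof.
have natk0 := (pcharf0P k).1 k_char0.
case: z => n; first by rewrite -pmulrn natk0.
by rewrite NegzE mulrNz oppr_eq0 -pmulrn natk0 oppr_eq0.
Qed.

Lemma intmxM m n p (A : 'M[int]_(m, n)) (B : 'M[int]_(n, p)) :
  (A *m B)^k = A^k *m B^k.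
Proof. exact: (map_mxM (intr : {rmorphism int -> k})). Qed.

(** The Smith normal form of a single row makes [c] an integer multiple [a] of the first row of a
    unimodular [R]. As [a] is nonzero in [k], it can be cancelled from the relation. *)
Lemma unimodular_killing_row n p (W : 'M[k]_(n.+1, p)) (c : 'rV[int]_n.+1) :
  c != 0 -> c^k *m W = 0 ->
  exists2 R : 'M[int]_n.+1, R \in unitmx & row 0 (R^k *m W) = 0.
Proof.
move=> c0 cW; have [L _ [R uR [d _ E]]] := int_Smith_normal_form c.
exists R => //; pose a := L 0 0 * d`_0.
have cE : c = a *: row 0 R.
  apply/rowP=> j; rewrite E !mxE (bigD1 0) //= big1 => [|i i0].
    by rewrite !mxE big_ord1 !mxE eqxx mulr1n addr0.
  rewrite !mxE big_ord1 !mxE eq_sym -(inj_eq val_inj) in i0 *.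
  by rewrite (negPf i0) mulr0 mul0r.
have a0 : intk a != 0.
  by rewrite intr_char0_eq0; apply: contraNneq c0 => a0; rewrite cE a0 scale0r.
apply: (scalerI a0); rewrite scaler0 -[RHS]cW cE row_mul scalemxAl.
by congr (_ *m W); apply/rowP=> j; rewrite !mxE intrM.
Qed.

Lemma mulmx_rsub0 m n p (u : 'rV[int]_(m + n)) (X : 'M[k]_(n, p)) :
  u^k *m col_mx 0 X = (rsubmx u)^k *m X.
Proof. by rewrite -{1}[u]hsubmxK map_row_mx mul_row_col mulmx0 add0r. Qed.

(** Induction on [n]: an integer relation among the rows of [W] is moved to row 0 by a unimodular
    matrix and the remaining rows are treated recursively. When no relation is left, the identity
    works with [r = 0]. *)
Lemma kernel_first_basis n p (W : 'M[k]_(n, p)) :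
  exists (s : 'M[int]_n) (r : nat), [/\ s \in unitmx, (r <= n)%N,
    forall i : 'I_n, (i < r)%N -> row i (s^k *m W) = 0 &
    forall c : 'rV[int]_n, (forall i : 'I_n, (i < r)%N -> c 0 i = 0) ->
      c^k *m (s^k *m W) = 0 -> c = 0].
Proof.
elim: n => [|n IHn] in W *.
  by exists 1%:M, 0; split=> [||[]|c _ _]; rewrite ?unitmx1 // thinmx0.
have [[c [c0 cW]]|indep] :=
    excluded_middle_informative (exists c : 'rV[int]_n.+1, c != 0 /\ c^k *m W = 0);
  last first.
  exists 1%:M, 0; split=> [||//|c _]; rewrite ?unitmx1 //.
  rewrite (map_mx1 (intr : {rmorphism int -> k})) mul1mx => cW.
  by apply/eqP/negP => /negP c0; apply: indep; exists c.
have [R uR R0] := unimodular_killing_row c0 cW.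
pose V : 'M_(1 + n, p) := R^k *m W.
have [s [r [us rn sker sind]]] := IHn (dsubmx V).
have VE : V = col_mx 0 (dsubmx V).
  rewrite -[LHS]vsubmxK; congr col_mx; apply/matrixP=> i j.
  rewrite ord1 !mxE (_ : lshift n 0 = 0); last exact: val_inj.
  by have /rowP/(_ j) := R0; rewrite !mxE.
(* The block matrix keeps the row already killed and changes basis only among the others. *)
pose t : 'M[int]_(1 + n) := block_mx 1%:M 0 0 s.
have tV : t^k *m V = col_mx 0 (s^k *m dsubmx V).
  rewrite {1}VE (map_block_mx intk) mul_block_col.
  rewrite !(map_mx0 (intr : {rmorphism int -> k})).
  by rewrite mulmx0 !mul0mx !add0r.
exists (t *m R), r.+1; split => //.
- rewrite unitmx_mul uR andbT unitmxE (det_ublock (1%:M : 'M_1)) det1 mul1r.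
  by rewrite -unitmxE.
- move=> i ir; rewrite intmxM -mulmxA -/V tV.
  apply/rowP=> l; rewrite [LHS]mxE.
  case: (@split_ordP 1 n i) ir => j -> /= jr.
    by apply: etrans (@col_mxEu _ 1 n p _ _ j l) _; rewrite !mxE.
  apply: etrans (@col_mxEd _ 1 n p _ _ j l) _.
  by have /rowP/(_ l) := sker j jr; rewrite mxE.
- move=> e e0; rewrite intmxM -mulmxA -/V tV => eV.
  have re0 : rsubmx (e : 'rV_(1 + n)) = 0.
    apply: sind => [i ir|]; first by rewrite mxE e0.
    by apply: etrans eV; apply: esym; apply: (@mulmx_rsub0 1 n p).
  rewrite -[e](@hsubmxK _ 1 1 n) re0.
  rewrite (_ : lsubmx (e : 'rV_(1 + n)) = 0) ?row_mx0 //.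
  by apply/rowP=> i; rewrite mxE e0 ?mxE //= ord1.
Qed.

(** Reversing the order of the rows puts the kernel last, so that its complement occupies the upper
    left block. *)
Lemma kernel_last_basis n p (W : 'M[k]_(n, p)) :
  exists (s : 'M[int]_n) (m : nat), [/\ s \in unitmx, (m <= n)%N,
    forall i : 'I_n, (m <= i)%N -> row i (s^k *m W) = 0 &
    forall c : 'rV[int]_n, (forall i : 'I_n, (m <= i)%N -> c 0 i = 0) ->
      c^k *m (s^k *m W) = 0 -> c = 0].
Proof.
have [s [r [us rn sker sind]]] := kernel_first_basis W.
pose q := perm rev_ord_inj : 'S_n.
have sub_rev (i : 'I_n) : (n - r <= i)%N -> (rev_ord i < r)%N.
  by move=> ri /=; rewrite ltn_subLR // addSn ltnS addnC -leq_subLR.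
exists (row_perm q s), (n - r)%N; split; rewrite ?leq_subr //.
- by rewrite row_permE unitmx_mul unitmx_perm.
- move=> i /sub_rev/sker/rowP E; apply/rowP=> j.
  rewrite -[RHS](E j) !mxE; apply: eq_bigr => l _.
  by rewrite !mxE permE.
- move=> c c0; pose c' : 'rV[int]_n := \row_i c 0 (rev_ord i).
  have -> : c^k *m ((row_perm q s)^k *m W) = c'^k *m (s^k *m W).
    rewrite !mulmxA -!intmxM; congr (map_mx _ _ *m W); apply/rowP=> j.
    rewrite !mxE (reindex_inj rev_ord_inj) /=; apply: eq_bigr => i _.
    by rewrite !mxE permE rev_ordK.
  move/sind => c'0; apply/rowP=> i; rewrite -[i]rev_ordK.
  have /rowP/(_ (rev_ord i)) : c' = 0; last by rewrite !mxE.
  by apply: c'0 => j jr; rewrite mxE c0 //= leq_sub2l.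
Qed.

(* Rows of W outside S vanish, so truncating the rows i < m of s to S changes
   them by kernel elements, i.e. by combinations of the rows i >= m: this
   multiplies s by 1 + N with N ^ 2 = 0. *)
Lemma kernel_last_basis_supp n p (W : 'M[k]_(n, p)) (S : pred 'I_n) :
  (forall i, ~~ S i -> row i W = 0) ->
  exists (s : 'M[int]_n) (m : nat), [/\ s \in unitmx, (m <= n)%N,
    forall i : 'I_n, (m <= i)%N -> row i (s^k *m W) = 0,
    forall c : 'rV[int]_n, (forall i : 'I_n, (m <= i)%N -> c 0 i = 0) ->
      c^k *m (s^k *m W) = 0 -> c = 0 &
    forall i j : 'I_n, (i < m)%N -> ~~ S j -> s i j = 0].
Proof.
move=> WS; have [s [m [us mn sker sind]]] := kernel_last_basis W.
pose t : 'M[int]_n := \matrix_(i, j) (if (i < m)%N && ~~ S j then 0 else s i j).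
have tW : t^k *m W = s^k *m W.
  apply/matrixP=> i j; rewrite !mxE; apply: eq_bigr => l _; rewrite !mxE.
  case: ifP => // /andP[_ /WS/rowP/(_ j)]; rewrite !mxE => ->.
  by rewrite !mulr0.
pose N := (t - s) *m invmx s.
have NW : N^k *m (s^k *m W) = 0.
  rewrite mulmxA -intmxM mulmxKV // (map_mxB (intr : {rmorphism int -> k})).
  by rewrite mulmxBl tW subrr.
(* Only entries with i < m <= j survive: the rows from [m] on were not truncated, and the part of a
   row of [N] in columns below [m] is an integer relation among the first [m] rows of [s^k *m W],
   hence trivial. *)
have N0 (i j : 'I_n) : (m <= i)%N || (j < m)%N -> N i j = 0.
  have [mi _|im /= jm] := leqP m i.
    rewrite mxE big1 // => l _; rewrite !mxE ltnNge mi /= subrr mul0r //.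
  pose c : 'rV[int]_n := \row_l (if (l < m)%N then N i l else 0).
  have: c = 0; last by move/rowP/(_ j); rewrite !mxE jm.
  apply: sind => [l|]; first by rewrite mxE ltnNge => ->.
  have := congr1 (row i) NW; rewrite row0 row_mul => <-.
  apply/rowP=> l; rewrite [LHS]mxE [RHS]mxE; apply: eq_bigr => h _.
  have [mh|hm] := leqP m h; last by rewrite !mxE hm.
  by have /rowP/(_ l) := sker h mh; rewrite [RHS]mxE mxE => ->; rewrite !mulr0.
have NN : N *m N = 0.
  apply/matrixP=> i j; rewrite [LHS]mxE [RHS]mxE big1 // => l _.
  have [ml|lm] := leqP m l; first by rewrite (N0 l) ?ml ?mulr0.
  by rewrite (N0 i) ?lm ?orbT ?mul0r.
have tE : t = (1%:M + N) *m s by rewrite mulmxDl mul1mx mulmxKV // addrC subrK.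
exists t, m; rewrite tW; split=> // [|i j im nS]; last by rewrite mxE im nS.
rewrite tE unitmx_mul us andbT.
have /mulmx1_unit[] : (1%:M + N) *m (1%:M - N) = 1%:M; last by [].
by rewrite mulmxDl mul1mx mulmxBr mulmx1 NN subr0 subrK.
Qed.

End AdaptedBasis.

(** * Subfields *)

Section Subfield.
Variables (F : fieldType) (S : divringClosed F).

(** Turns a closed subset into a [fieldType] of its own; the Poisson centre becomes the coefficient
    field [K] in this way. *)
Record subfield_of := SubfieldOf { subfield_val : F; _ : subfield_val \in S }.

HB.instance Definition _ := [isSub for subfield_val].
HB.instance Definition _ := [Choice of subfield_of by <:].
HB.instance Definition _ := [SubChoice_isSubIntegralDomain of subfield_of by <:].
HB.instance Definition _ := [SubIntegralDomain_isSubField of subfield_of by <:].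

Lemma subfield_rmorphism (R : nzRingType) (f : {rmorphism R -> F}) :
  (forall c, f c \in S) ->
  exists g : {rmorphism R -> subfield_of}, forall c, val (g c) = f c.
Proof.
move=> fS; pose g c := SubfieldOf (fS c).
have gZ : zmod_morphism g by move=> x y; apply: val_inj; rewrite /= rmorphB.
have gM : monoid_morphism g.
  by split=> [|x y]; apply: val_inj; rewrite /= ?rmorph1 ?rmorphM.
pose zM := GRing.isZmodMorphism.Build _ _ g gZ.
pose mM := GRing.isMonoidMorphism.Build _ _ g gM.
pose h : {rmorphism R -> subfield_of} := HB.pack g zM mM.
by exists h.
Qed.

End Subfield.

Lemma rmorph_bij_inv (E F : fieldType) (psi : {rmorphism E -> F}) :
    (forall z, exists u, psi u = z) ->
  exists phi : {rmorphism F -> E}, cancel psi phi /\ cancel phi psi.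
Proof.
move=> surj.
pose g z := proj1_sig (constructive_indefinite_description _ (surj z)).
have gK : cancel g psi.
  by move=> z; apply: (proj2_sig (constructive_indefinite_description _ (surj z))).
have psiK : cancel psi g by move=> u; apply: (fmorph_inj psi); apply: gK.
pose zM := GRing.isZmodMorphism.Build _ _ g (can2_zmod_morphism psiK gK).
pose mM := GRing.isMonoidMorphism.Build _ _ g (can2_monoid_morphism psiK gK).
by pose phi : {rmorphism F -> E} := HB.pack g zM mM; exists phi.
Qed.

(** * Generation of fields *)

Record field_ops_closed (F : fieldType) (Q : F -> Prop) : Prop := FieldOpsClosed {
  closedD : forall x y, Q x -> Q y -> Q (x + y);
  closedM : forall x y, Q x -> Q y -> Q (x * y);
  closedV : forall x, Q x -> Q x^-1 }.

(** Generation is encoded as an induction principle, the form in which it is applied to vanishing of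
    brackets, compatibility with brackets and membership in an image. *)
Definition field_generated (C I : Type) (F : fieldType)
    (c : C -> F) (x : I -> F) : Prop :=
  forall Q : F -> Prop, field_ops_closed Q ->
    (forall a, Q (c a)) -> (forall j, Q (x j)) -> forall z, Q z.

Lemma der_eq_closed (E F : fieldType) (psi : {rmorphism E -> F}) d d' :
    derivation_along id d -> derivation_along id d' ->
  field_ops_closed (fun u => psi (d u) = d' (psi u)).
Proof.
move=> dd dd'; split=> [x y Qx Qy|x y Qx Qy|x Qx].
- by rewrite rmorphD (derD dd) (derD dd') rmorphD Qx Qy.
- by rewrite rmorphM (derM dd) (derM dd') rmorphD !rmorphM Qx Qy.
- by rewrite fmorphV (derV dd) (derV dd') rmorphN !rmorphM fmorphV Qx.
Qed.

Lemma der_kernel_closed (F : fieldType) (d : F -> F) :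
  derivation_along id d -> field_ops_closed (fun u => d u = 0).
Proof.
move=> dd; split=> [x y Qx Qy|x y Qx Qy|x Qx].
- by rewrite (derD dd) Qx Qy addr0.
- by rewrite (derM dd) Qx Qy mulr0 mul0r addr0.
- by rewrite (derV dd) Qx mulr0 oppr0.
Qed.

Lemma image_closed (E F : fieldType) (psi : {rmorphism E -> F}) :
  field_ops_closed (fun z => exists u, psi u = z).
Proof.
split=> [_ _ [u <-] [v <-]|_ _ [u <-] [v <-]|_ [u <-]].
- by exists (u + v); rewrite rmorphD.
- by exists (u * v); rewrite rmorphM.
- by exists u^-1; rewrite fmorphV.
Qed.

Lemma closed_prod (F : fieldType) (Q : F -> Prop) (I : Type) (r : seq I) G :
  field_ops_closed Q -> Q 1 -> (forall i, Q (G i)) -> Q (\prod_(i <- r) G i).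
Proof. by move=> HQ Q1 QG; elim/big_ind: _ => //; apply: closedM. Qed.

Lemma closed_exp (F : fieldType) (Q : F -> Prop) (x : F) n :
  field_ops_closed Q -> Q 1 -> Q x -> Q (x ^+ n).
Proof.
by move=> HQ Q1 Qx; elim: n => // n IHn; rewrite exprS; apply: closedM.
Qed.

Lemma closed_expz (F : fieldType) (Q : F -> Prop) (x : F) (z : int) :
  field_ops_closed Q -> Q 1 -> Q x -> Q (x ^ z).
Proof.
move=> HQ Q1 Qx; case: z => n; first exact: closed_exp.
by rewrite NegzE -exprnN; apply: closedV => //; apply: closed_exp.
Qed.

(** The surjection [f] covers two cases at once: the projection onto A/P, and the identity of
    K[y_1, ..., y_m]. *)
Lemma frac_mpoly_generated (R : comNzRingType) n (D : idomainType)
    (f : {rmorphism {mpoly R[n]} -> D}) : (forall a, exists p, f p = a) ->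
  field_generated (fun c => (f c%:MP)%:F) (fun j => (f 'X_j)%:F).
Proof.
move=> surj Q HQ QC QX.
have Q1 : Q 1 by rewrite -tofrac1 -(rmorph1 f) -mpolyC1.
have Qf p : Q (f p)%:F.
  elim/mpolyind: p => [|c m p _ _ Qp]; first by rewrite -mpolyC0.
  rewrite rmorphD tofracD; apply: closedD => //.
  rewrite -mul_mpolyC rmorphM tofracM; apply: closedM => //.
  rewrite mpolyXE_id rmorph_prod (rmorph_prod (@FracField.tofrac D)) /=.
  apply: closed_prod => // i; rewrite rmorphXn tofracXn.
  exact: closed_exp.
move=> z; have [a [b [_ ->]]] := fracP z.
have [p <-] := surj a; have [q <-] := surj b.
by apply: closedM => //; apply: closedV.
Qed.

(** * The log-canonical bracket on polynomials and on their quotients *)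

Section QBracket.
Variables (R : comNzRingType) (n : nat) (lam : 'M[R]_n).

Lemma qbracket_bider : antisym_mx lam -> skew_bider (qbracket lam).
Proof.
move=> lamN; split=> [f g|h f g|h f g]; rewrite /qbracket.
- rewrite exchange_big -sumrN; apply: eq_bigr => i _.
  rewrite -sumrN; apply: eq_bigr => j _.
  have /matrixP/(_ i j) := lamN; rewrite !mxE => ->.
  by rewrite scaleNr; congr (- (_ *: _)); ring.
- rewrite -big_split; apply: eq_bigr => i _; rewrite -big_split.
  apply: eq_bigr => j _ /=; rewrite mderivD -scalerDr; congr (_ *: _); ring.
- rewrite mulr_sumr mulr_suml -big_split; apply: eq_bigr => i _.
  rewrite mulr_sumr mulr_suml -big_split; apply: eq_bigr => j _ /=.
  rewrite mderivM -scalerAr -scalerAl -scalerDr; congr (_ *: _); ring.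
Qed.

Lemma qbracketC c g : qbracket lam c%:MP g = 0.
Proof.
rewrite /qbracket big1 // => i _; rewrite big1 // => j _.
by rewrite mderivC mulr0 mul0r scaler0.
Qed.

Lemma qbracketX i j : qbracket lam 'X_i 'X_j = lam i j *: ('X_i * 'X_j).
Proof.
have dX (a b : 'I_n) : ('X_a)^`M(b) = (a == b)%:R :> {mpoly R[n]}.
  rewrite mderivX mnm1E; case: eqP => [->|_]; last by rewrite scale0r.
  rewrite scale1r (_ : (_ - _)%MM = 0%MM) ?mpolyX0 //.
  by apply/mnmP=> a'; rewrite mnmBE subnn mnm0E.
rewrite /qbracket (bigD1 i) //= (bigD1 j) //= !dX !eqxx !mulr1.
rewrite -[RHS]addr0 -addrA; congr (_ + _).
rewrite big1 ?add0r => [|b bj]; last first.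
  by rewrite !dX [j == b]eq_sym (negPf bj) !mulr0 scaler0.
rewrite big1 // => a ai; rewrite big1 // => b _.
by rewrite dX [i == a]eq_sym (negPf ai) mulr0 mul0r scaler0.
Qed.

End QBracket.

Section QuotBracket.
Variables (R : comNzRingType) (n : nat) (lam : 'M[R]_n).
Variable P : prime_idealr {mpoly R[n]}.
Hypotheses (lam_anti : antisym_mx lam) (P_poisson : poisson_ideal lam P).

(** Changing representatives alters the bracket by {a', b' - b} - {b, a' - a}, and both terms lie in
    the Poisson ideal [P]. *)
Lemma quot_bracket_pi a b :
  quot_bracket lam (\pi_(pquot P) a) (\pi_(pquot P) b) =
  \pi_(pquot P) (qbracket lam a b).
Proof.
have qb := qbracket_bider lam_anti.
rewrite /quot_bracket; set a' := repr _; set b' := repr _.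
have aP : a' - a \in P by rewrite Quotient.idealrBE reprK.
have bP : b' - b \in P by rewrite Quotient.idealrBE reprK.
apply/eqP; rewrite -Quotient.idealrBE.
have -> : qbracket lam a' b' - qbracket lam a b =
    qbracket lam a' (b' - b) - qbracket lam b (a' - a).
  have rl z := bider_derl qb z; have rr z := bider_derr qb z.
  rewrite (derD (rr _)) (derN (rr _)) (bider_skew qb b) opprK (derD (rl _)) (derN (rl _)).
  by rewrite addrA addrNK.
by rewrite rpredB //; apply: P_poisson.
Qed.

Lemma quot_bracket_bider : skew_bider (quot_bracket lam (P := P)).
Proof.
have qb := qbracket_bider lam_anti.
split=> [x y|z x y|z x y]; elim/quotW: x => x; elim/quotW: y => y.
- by rewrite !quot_bracket_pi (bider_skew qb) rmorphN.
- by elim/quotW: z => z; rewrite -rmorphD !quot_bracket_pi (bider_addl qb) rmorphD.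
- elim/quotW: z => z.
  by rewrite -rmorphM !quot_bracket_pi (bider_mull qb) rmorphD !rmorphM.
Qed.

End QuotBracket.

(** * Linear independence of joint eigenvectors *)

(** Induction on [s]. For [g] in the tail some [T j] separates it from the head [g0]; applying [T j]
    minus the eigenvalue of [g0] removes the head and rescales the tail by elements of [k], which
    preserves eigenvalues. Vectors may be zero, so the rescaled family is again admissible. *)
Lemma joint_eigenvectors_indep (k F : fieldType) (i : {rmorphism k -> F})
    (I : eqType) (J : Type) (T : J -> F -> F) (w : J -> I -> k)
    (u : I -> F) (s : seq I) :
    (forall j x y, T j (x + y) = T j x + T j y) ->
    (forall j c x, T j (i c * x) = i c * T j x) ->
    (forall j g, T j (u g) = i (w j g) * u g) ->
    {in s &, forall g h, (forall j, w j g = w j h) -> g = h} -> uniq s ->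
  \sum_(g <- s) u g = 0 -> {in s, forall g, u g = 0}.
Proof.
move=> TD TZ; elim: s u => // g0 s IHs u Tu inj /= /andP[g0s us].
rewrite big_cons => sum0.
have T0 j : T j 0 = 0 by apply: (addrI (T j 0)); rewrite -TD !addr0.
have us0 : {in s, forall g, u g = 0}.
  move=> g gs.
  have [j wj] : exists j, w j g != w j g0.
    apply: NNPP => nw; case/negP: g0s; rewrite -(inj g g0) ?inE ?gs ?eqxx ?orbT //.
    by move=> j; apply/eqP/negP => /negP nj; apply: nw; exists j.
  have sumw0 :
      \sum_(h <- s) i (w j h - w j g0) * u h = 0.
    have := congr1 (T j) sum0; rewrite TD Tu (big_morph _ (TD j) (T0 j)) T0.
    rewrite -[in RHS](mulr0 (i (w j g0))) -[in RHS]sum0 mulrDr => /addrI/eqP.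
    rewrite -subr_eq0 mulr_sumr -sumrB => /eqP E; rewrite -[RHS]E.
    by apply: eq_bigr => h _; rewrite Tu rmorphB mulrBl.
  have /eqP : i (w j g - w j g0) * u g = 0.
    apply: (IHs (fun h => i (w j h - w j g0) * u h)) => // [j' h|h h' hs h's].
      by rewrite TZ Tu; ring.
    by apply: inj; rewrite inE ?hs ?h's orbT.
  by rewrite mulf_eq0 fmorph_eq0 subr_eq0 (negPf wj) => /eqP.
move=> g; rewrite inE => /predU1P[->|/us0 //].
by move: sum0; rewrite big1_seq ?addr0.
Qed.

(** * Fields generated by log-canonical elements *)

(** Each [B^~ x] is a derivation, and a common kernel of derivations of a field is a subfield.
    Excluded middle makes membership boolean. *)
Lemma poisson_centre_divring (F : fieldType) (B : F -> F -> F) :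
  skew_bider B ->
  exists S : divringClosed F, forall z, z \in S <-> forall x, B z x = 0.
Proof.
move=> HB.
pose S : {pred F} := fun z =>
  if excluded_middle_informative (forall x, B z x = 0) then true else false.
have SP z : z \in S <-> forall x, B z x = 0.
  by rewrite unfold_in /S; case: excluded_middle_informative.
have Sdr : divring_closed S.
  split=> [|x y /SP Bx /SP By|x y /SP Bx /SP By]; apply/SP=> z;
    have dz := bider_derl HB z.
  - exact: der1 dz erefl.
  - by rewrite (derD dz) (derN dz) Bx By subrr.
  - by rewrite (derM dz) (derV dz) Bx By mulr0 oppr0 mulr0 mul0r addr0.
pose T : divringClosed F := HB.pack S (GRing.isDivringClosed.Build F S Sdr).
by exists T.
Qed.

Section Monomials.
Variables (k F : fieldType) (B : F -> F -> F) (HB : skew_bider B).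
Variables (i : {rmorphism k -> F}) (n : nat) (L : 'M[k]_n) (eta : 'I_n -> F).
Hypothesis eta0 : forall a, eta a != 0.
Hypothesis Beta : forall a b, B (eta a) (eta b) = i (L a b) * eta a * eta b.

Definition lmonomial (v : 'I_n -> int) : F := \prod_a eta a ^ v a.

Lemma lmonomial_neq0 v : lmonomial v != 0.
Proof. by rewrite /lmonomial prodf_seq_neq0; apply/allP=> a _; rewrite expfz_neq0. Qed.

Lemma bracket_lmonomial_eta v b :
  B (lmonomial v) (eta b) =
  i (\sum_a (v a)%:~R * L a b) * lmonomial v * eta b.
Proof.
have dd := bider_derl HB (eta b).
apply: (mulIf (invr_neq0 (lmonomial_neq0 v))).
rewrite /lmonomial (dlog_prod dd) => [|a]; last by rewrite expfz_neq0.
rewrite mulrAC mulfK ?lmonomial_neq0 // rmorph_sum mulr_suml.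
apply: eq_bigr => a _; rewrite (dlogXz dd) // Beta rmorphM rmorph_int.
by have := eta0 a => a0; field.
Qed.

(** Laurent monomials are again log-canonical, their exponent vectors being paired by [L]; for the
    rows of [s] the constants are the entries of s L s^T. *)
Lemma bracket_lmonomial v v' :
  B (lmonomial v) (lmonomial v') =
  i (\sum_b (\sum_a (v a)%:~R * L a b) * (v' b)%:~R) * lmonomial v * lmonomial v'.
Proof.
have dd := bider_derr HB (lmonomial v).
apply: (mulIf (invr_neq0 (lmonomial_neq0 v'))).
rewrite {1 2}[lmonomial v']/lmonomial (dlog_prod dd) => [|a];
  last by rewrite expfz_neq0.
rewrite mulfK ?lmonomial_neq0 // rmorph_sum mulr_suml.
apply: eq_bigr => b _; rewrite (dlogXz dd) // bracket_lmonomial_eta.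
by rewrite [in RHS]rmorphM rmorph_int mulfK //; ring.
Qed.

(** The multiplicative form of [invmx s *m s = 1]: unimodularity makes the exponents integral. *)
Lemma eta_lmonomial (s : 'M[int]_n) a : s \in unitmx ->
  eta a = \prod_j lmonomial (s j) ^ (invmx s a j).
Proof.
move=> us; transitivity (\prod_b eta b ^ ((1%:M : 'M[int]_n) a b)).
  rewrite (bigD1 a) //= mxE eqxx expr1z big1 ?mulr1 // => b ba.
  by rewrite mxE eq_sym (negPf ba) expr0z.
rewrite -(mulVmx us) /lmonomial.
transitivity (\prod_b \prod_j eta b ^ (invmx s a j * s j b)).
  apply: eq_bigr => b _; rewrite mxE.
  by apply: (big_morph (fun z : int => eta b ^ z)) => // x y; rewrite expfzDr.
rewrite exchange_big; apply: eq_bigr => j _ /=.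
rewrite (big_morph (fun x : F => x ^ invmx s a j) (id1 := 1) (op1 := *%R)).
- by apply: eq_bigr => b _; rewrite mulrC exprz_exp.
- by move=> x y; rewrite expfzMl.
- by rewrite exp1rz.
Qed.

End Monomials.

(** * Algebraic independence over central constants *)

Section Independence.
Variables (k F K : fieldType) (B : F -> F -> F) (HB : skew_bider B).
Variables (i : {rmorphism k -> F}) (j : {rmorphism K -> F}).
Hypotheses (Bi : forall c x, B (i c) x = 0) (Bj : forall c x, B (j c) x = 0).
Variables (m n : nat) (M : 'M[k]_(m, n)) (y : 'I_m -> F) (eta : 'I_n -> F).
Hypotheses (y0 : forall a, y a != 0) (eta0 : forall b, eta b != 0).
Hypothesis By : forall a b, B (y a) (eta b) = i (M a b) * y a * eta b.
Hypothesis M_indep : forall c : 'rV[int]_m,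
  map_mx (fun z : int => z%:~R : k) c *m M = 0 -> c = 0.

(** A polynomial vanishing at [y] is a vanishing sum of joint eigenvectors, since its coefficients
    are central. By [M_indep], different exponents give different eigenvalues, so every term
    vanishes. *)
Lemma mmap_eigen_inj : injective (mmap j y).
Proof.
suff inj0 p : mmap j y p = 0 -> p = 0.
  move=> p q /eqP; rewrite -subr_eq0 -rmorphB => /eqP/inj0/eqP.
  by rewrite subr_eq0 => /eqP.
have y1 (mm : 'X_{1..m}) : mmap1 y mm != 0.
  by rewrite /mmap1 prodf_seq_neq0; apply/allP=> a _; rewrite expf_neq0.
pose T b x := B x (eta b) / eta b.
pose w b (mm : 'X_{1..m}) : k := \sum_a (mm a)%:R * M a b.
have Ty b mm : B (mmap1 y mm) (eta b) = i (w b mm) * mmap1 y mm * eta b.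
  have dd := bider_derl HB (eta b).
  apply: (mulIf (invr_neq0 (y1 mm))).
  rewrite /mmap1 (dlog_prod dd) => [|a]; last by rewrite expf_neq0.
  rewrite mulrAC mulfK ?(y1 mm) // rmorph_sum mulr_suml.
  apply: eq_bigr => a _; rewrite (dlogX dd) // By rmorphM rmorph_nat.
  by have := y0 a => a0; field.
rewrite /mmap => sum0; apply/mpolyP=> mm; rewrite mcoeff0.
have [ms|] := boolP (mm \in msupp p); last exact: memN_msupp_eq0.
have /eqP : j p@_mm * mmap1 y mm = 0; last first.
  by rewrite mulf_eq0 (negPf (y1 mm)) orbF fmorph_eq0 => /eqP.
move: mm ms; apply: (joint_eigenvectors_indep (i := i) (T := T) (w := w)) => //.
- by move=> b x z; rewrite /T (bider_addl HB) mulrDl.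
- by move=> b c x; rewrite /T (bider_mull HB) Bi mul0r addr0 mulrA.
- move=> b g; rewrite /T (bider_mull HB) Bj mul0r addr0 Ty.
  by rewrite !mulrA mulfK // [j _ * i _]mulrC.
- move=> g h _ _ wgh; apply/mnmP=> a.
  pose c : 'rV[int]_m := \row_a ((g a)%:Z - (h a)%:Z).
  have /rowP/(_ a) : c = 0; last by rewrite !mxE => /eqP; rewrite subr_eq0 => /eqP[].
  apply: M_indep; apply/rowP=> b; rewrite !mxE.
  have /eqP := wgh b; rewrite -subr_eq0 -sumrB => /eqP E; rewrite -[RHS]E.
  by apply: eq_bigr => l _; rewrite !mxE intrB mulrBl.
Qed.

End Independence.

(** The argument uses only that [F] is generated over central constants by log-canonical elements.
    Some [xi a] may be zero, as happens when [P] contains variables. *)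
Theorem log_canonical_field (k F : fieldType) (k_char0 : [pchar k] =i pred0)
    (B : F -> F -> F) (HB : skew_bider B) (i : {rmorphism k -> F})
    (n : nat) (lam : 'M[k]_n) (lam_anti : antisym_mx lam) (xi : 'I_n -> F) :
    (forall c x, B (i c) x = 0) ->
    (forall a b, B (xi a) (xi b) = i (lam a b) * xi a * xi b) ->
    field_generated i xi ->
  exists (K : fieldType) (iota : {rmorphism k -> K})
         (m : nat) (le_mn : (m <= n)%N) (mu : 'M[k]_m),
    [/\ antisym_mx mu,
        exists Phi : {rmorphism F -> {fraction {mpoly K[m]}}},
          [/\ bijective Phi,
              forall c : k, Phi (i c) = ((iota c)%:MP)%:F
            & forall x y : F,
                Phi (B x y) = ratfun_bracket iota mu (Phi x) (Phi y)]
      & exists sigma : 'M[int]_n,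
          sigma \in unitmx /\
          let S := map_mx (fun z : int => z%:~R) sigma *m lam
                   *m (map_mx (fun z : int => z%:~R) sigma)^T in
          mu = \matrix_(i < m, j < m) S (widen_ord le_mn i) (widen_ord le_mn j)].
Proof.
move=> Bi Bxi gen.
have B1l x : B 1 x = 0 := der1 (bider_derl HB x) erefl.
have B1r x : B x 1 = 0 := der1 (bider_derr HB x) erefl.
pose eta a := if xi a == 0 then 1 else xi a.
pose L : 'M[k]_n := \matrix_(a, b)
  (if (xi a != 0) && (xi b != 0) then lam a b else 0).
have eta0 a : eta a != 0.
  by rewrite /eta; case: (eqVneq (xi a)) => // _; apply: oner_neq0.
have Beta a b : B (eta a) (eta b) = i (L a b) * eta a * eta b.
  rewrite /eta mxE; case: eqP => /= _; first by rewrite B1l rmorph0 !mul0r.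
  by case: eqP => /= _; rewrite ?B1r ?rmorph0 ?mul0r.
have gen_eta : field_generated i eta.
  move=> Q HQ Qi Qeta; apply: gen => // a.
  by have := Qeta a; rewrite /eta; case: eqP => [->|//]; rewrite -(rmorph0 i).
have L_supp a : ~~ (xi a != 0) -> row a L = 0.
  by move=> /negPf xa; apply/rowP=> b; rewrite !mxE xa.
have [s [m [us mn sker sind ssupp]]] := kernel_last_basis_supp k_char0 L_supp.
have [S SP] := poisson_centre_divring HB.
pose K : fieldType := subfield_of S.
pose j : {rmorphism K -> F} := val.
have Bj c x : B (j c) x = 0 by case: c => c cS; move/SP: (cS).
have iS c : i c \in S by apply/SP=> x; apply: Bi.
have [iota iotaE] := subfield_rmorphism iS.
pose Sig := map_mx (fun z : int => z%:~R) s *m lam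
                   *m (map_mx (fun z : int => z%:~R) s)^T.
pose mu : 'M[k]_m := \matrix_(a, b) Sig (widen_ord mn a) (widen_ord mn b).
have mu_anti : antisym_mx mu.
  have minorN (X : 'M[k]_n) : X^T = - X ->
      antisym_mx (\matrix_(a < m, b < m) X (widen_ord mn a) (widen_ord mn b)).
    move=> XT; apply/matrixP=> a b.
    by have /matrixP/(_ (widen_ord mn a) (widen_ord mn b)) := XT; rewrite !mxE.
  by apply: minorN; rewrite /Sig !trmx_mul trmxK lam_anti mulNmx mulmxN mulmxA.
pose y a := lmonomial eta (s (widen_ord mn a)).
have y0 a : y a != 0 by apply: lmonomial_neq0.
have By_eta a b : B (lmonomial eta (s a)) (eta b) =
    i ((map_mx (fun z : int => z%:~R) s *m L) a b) * lmonomial eta (s a) * eta b.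
  rewrite (bracket_lmonomial_eta HB eta0 Beta) mxE; congr (i _ * _ * _).
  by apply: eq_bigr => c _; rewrite [map_mx _ _ _ _]mxE.
(* The brackets are governed by [L] but [mu] is built from [lam]. The two matrices differ only in
   rows and columns where [xi] vanishes, and there the first [m] rows of [s] are zero, so the upper
   left blocks agree. *)
have s_supp (a : 'I_m) c : xi c = 0 -> (s (widen_ord mn a) c)%:~R = 0 :> k.
  by move=> xc; rewrite ssupp ?xc ?eqxx ?mulr0z //= ltn_ord.
have By a b : B (y a) (y b) = i (mu a b) * y a * y b.
  rewrite (bracket_lmonomial HB eta0 Beta); congr (i _ * _ * _).
  rewrite !mxE; apply: eq_bigr => c _; rewrite [_^T _ _]mxE [map_mx _ _ _ _]mxE.
  have [/s_supp ->|xc] := eqVneq (xi c) 0; first by rewrite !mulr0.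
  congr (_ * _); rewrite mxE; apply: eq_bigr => d _.
  rewrite [map_mx _ _ _ _]mxE [L _ _]mxE xc andbT.
  by case: eqVneq => //= /s_supp ->; rewrite !mul0r.
have ker_central (a : 'I_n) : (m <= a)%N -> lmonomial eta (s a) \in S.
  move=> ma; apply/SP; apply: (gen_eta (fun x => B (lmonomial eta (s a)) x = 0)).
  - exact: der_kernel_closed (bider_derr HB _).
  - by move=> c; rewrite (bider_skew HB) Bi oppr0.
  - move=> b; rewrite By_eta; have /rowP/(_ b) := sker a ma.
    by rewrite [in LHS]mxE => ->; rewrite mxE rmorph0 !mul0r.
pose M : 'M[k]_(m, n) :=
  \matrix_(a, b) (map_mx (fun z : int => z%:~R) s *m L) (widen_ord mn a) b.
have M_indep (c : 'rV[int]_m) : map_mx (fun z : int => z%:~R : k) c *m M = 0 -> c = 0.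
  (* [e] is [c] padded by zeros to length [n], the form required by [sind]. *)
  pose e : 'rV[int]_n := \row_a oapp (c 0) 0 (insub (val a) : option 'I_m).
  have ew a : e 0 (widen_ord mn a) = c 0 a.
    by rewrite mxE /= insubT // => lt_am; congr (c 0 _); apply: val_inj.
  have e_out (a : 'I_n) : (m <= a)%N -> e 0 a = 0.
    by move=> ma; rewrite mxE insubF // ltnNge ma.
  move=> cM; suff e0 : e = 0 by apply/rowP=> a; rewrite -ew e0 !mxE.
  apply: sind => //; rewrite -[RHS]cM; apply/rowP=> b.
  rewrite [LHS]mxE [RHS]mxE.
  rewrite (bigID (fun a : 'I_n => (a < m)%N)) /= [X in _ + X]big1 ?addr0; last first.
    by move=> a; rewrite -leqNgt => ma; rewrite [map_mx _ e _ _]mxE e_out // mul0r.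
  rewrite (big_ord_narrow mn); apply: eq_bigr => a _.
  by rewrite [map_mx _ e _ _]mxE ew [M _ _]mxE [map_mx _ c _ _]mxE.
have psi0_inj : injective (mmap j y).
  apply: (mmap_eigen_inj HB Bi Bj y0 eta0 _ M_indep) => a b.
  by rewrite By_eta [M _ _]mxE.
pose psi0 : {rmorphism {mpoly K[m]} -> F} := mmap j y.
have [psi psiE] := frac_extend (psi0_inj : injective psi0).
have psi_mmap p : psi p%:F = mmap j y p := psiE p.
have psiC c : psi (c%:MP)%:F = j c by rewrite psi_mmap mmapC.
have psiX a : psi ('X_a)%:F = y a by rewrite psi_mmap mmapX mmap1U.
(* Each [eta a] is a Laurent monomial in the [lmonomial eta (s b)]: those with [b < m] are images of
   variables, the others are central and so are images of constants. *)
have psi_surj z : exists u, psi u = z.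
  move: z; apply: (gen_eta) => [|c|a]; first exact: image_closed.
    by exists ((iota c)%:MP)%:F; rewrite psiC; apply: iotaE.
  rewrite (eta_lmonomial eta0 a us).
  have im1 : exists u, psi u = 1 by exists 1; rewrite rmorph1.
  have imc := image_closed psi.
  apply: (closed_prod _ imc) => // b; apply: (closed_expz _ imc) => //.
  have [mb|bm] := leqP m b.
    by exists ((SubfieldOf (ker_central b mb) : K)%:MP)%:F; rewrite psiC.
  exists ('X_(Ordinal bm))%:F; rewrite psiX /y.
  by congr (lmonomial _ (s _)); apply: val_inj.
have [phi [psiK phiK]] := rmorph_bij_inv psi_surj.
have qb : skew_bider (qbracket (map_mx iota mu)).
  apply: qbracket_bider; rewrite /antisym_mx map_trmx mu_anti.
  by rewrite map_mxN.
have HB' : skew_bider (ratfun_bracket iota mu) := frac_bracket_bider qb.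
have B'E := frac_bracket_tofrac qb.
have id_surj (p : {mpoly K[m]}) :
  exists q, (idfun : {rmorphism {mpoly K[m]} -> _}) q = p by exists p.
have gen' := frac_mpoly_generated id_surj.
have B'C c v : ratfun_bracket iota mu (c%:MP)%:F v = 0.
  move: v; apply: (gen') => [|c'|b]; first exact: der_kernel_closed (bider_derr HB' _).
    by rewrite /ratfun_bracket B'E qbracketC tofrac0.
  by rewrite /ratfun_bracket B'E qbracketC tofrac0.
(* Both sides obey the Leibniz rule in each argument, so it suffices to compare them on constants
   and variables. *)
have psiB u v : psi (ratfun_bracket iota mu u v) = B (psi u) (psi v).
  move: u; apply: (gen') => [|c|a].
  - exact: der_eq_closed (bider_derl HB' v) (bider_derl HB (psi v)).
  - by rewrite B'C rmorph0 psiC Bj.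
  move: v; apply: (gen') => [|c|b].
  - exact: der_eq_closed (bider_derr HB' _) (bider_derr HB (psi _)).
  - by rewrite (bider_skew HB') (bider_skew HB) B'C oppr0 rmorph0 psiC Bj oppr0.
  rewrite /ratfun_bracket B'E qbracketX -mul_mpolyC !tofracM !rmorphM psiC !psiX By.
  rewrite [map_mx _ _ _ _]mxE mulrA.
  by congr (_ * _ * _); apply: iotaE.
exists K, iota, m, mn, mu; split=> //.
  exists phi; split=> [|c|x z]; first by exists psi.
    by rewrite -[RHS]psiK psiC /= iotaE.
  by rewrite -[RHS]psiK psiB !phiK.
by exists s.
Qed.

(** * Application to the fraction field of A/P *)

Theorem theorem3p4 (k : fieldType) (k_char0 : [pchar k] =i pred0)
    (n : nat) (lam : 'M[k]_n) (lam_anti : antisym_mx lam)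
    (P : prime_idealr {mpoly k[n]}) (P_poisson : poisson_ideal lam P) :
  exists (K : fieldType) (iota : {rmorphism k -> K})
         (m : nat) (le_mn : (m <= n)%N) (mu : 'M[k]_m),
    [/\ antisym_mx mu,
        (* Fract(A/P) ~= K_mu(y_1..y_m) as Poisson k-algebras *)
        exists Phi : {rmorphism FractQ P -> {fraction {mpoly K[m]}}},
          [/\ bijective Phi,
              forall c : k,
                Phi ((\pi_(pquot P) c%:MP)%:F) = ((iota c)%:MP)%:F
            & forall x y : FractQ P,
                Phi (frac_bracket (quot_bracket lam (P:=P)) x y)
                = ratfun_bracket iota mu (Phi x) (Phi y)]
      & (* mu is the upper-left m x m block of sigma lam sigma^T *)
        exists sigma : 'M[int]_n,
          sigma \in unitmx /\
          let S := map_mx (fun z : int => z%:~R) sigma *m lam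
                   *m (map_mx (fun z : int => z%:~R) sigma)^T in
          mu = \matrix_(i < m, j < m) S (widen_ord le_mn i) (widen_ord le_mn j)].
Proof.
have qb := quot_bracket_bider lam_anti P_poisson.
have HB := frac_bracket_bider qb; have BE := frac_bracket_tofrac qb.
pose pi : {rmorphism {mpoly k[n]} -> pquot P} := \pi_(pquot P).
pose i : {rmorphism k -> FractQ P} := @FracField.tofrac (pquot P) \o pi \o @mpolyC n k.
have pi_surj a : exists p, pi p = a by exists (repr a); apply: reprK.
have gen := frac_mpoly_generated pi_surj.
have iE c : i c = (pi c%:MP)%:F by [].
(* The generators are the classes of the variables. What remains is centrality of the constants, the
   log-canonical relations and generation. *)
apply: (log_canonical_field k_char0 HB (i := i) lam_anti (xi := fun a => (pi 'X_a)%:F)).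
- move=> c x; move: x; apply: (gen) => [|c'|b].
  + exact: der_kernel_closed (bider_derr HB _).
  + by rewrite iE BE quot_bracket_pi // qbracketC rmorph0 tofrac0.
  + by rewrite iE BE quot_bracket_pi // qbracketC rmorph0 tofrac0.
- move=> a b; rewrite BE quot_bracket_pi // qbracketX iE -mul_mpolyC.
  by rewrite !rmorphM mulrA.
- exact: gen.
Qed.
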